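(* For every $d \geq 1$, there exists an evenly distributed family $\{X_i^d\}_{i=1}^{\infty}$ of finite point sets in $B^d\subset\mathbb{R}^d$ with $$L(X_i^d) = \Theta\left(|X_i^d|^{\frac{2}{d} - \frac{1}{d2^{d-1}}}\right) \quad\text{as } i\to\infty.$$
   Context: The superscript $d$ in $X_i^d$ is an index indicating the dimension, not a power. $B^d$ denotes the closed Euclidean unit ball in $\mathbb{R}^d$ centered at the origin. For a set $A \subset \mathbb{R}^d$ (with at least two points), $\mu(A)$ denotes the minimum Euclidean distance between distinct points of $A$. Layer number: for a finite set $X \subset \mathbb{R}^d$, let $V(X)$ be the set of vertices (extreme points) of the convex hull $\mathrm{conv}\, X$. The peeling process starts with $X$ and in each step deletes from the current set all vertices of its convex hull, i.e. replaces the current set $Y$ by $Y \setminus V(Y)$, until the empty set is reached. The layer number $L(X)$ is the number of steps required to reach the empty set. Evenly distributed family: a family of finite sets $X_1, X_2, X_3, \dots \subset B^d$ is evenly distributed if $|X_i| \to \infty$ and $\mu(X_i) = \Theta(|X_i|^{-1/d})$ as $i\to\infty$, where the implied constants in $\Theta$ may depend on $d$ and on the family. The implied constants in the conclusion may depend on $d$ and on the constants in the asymptotic bound $\mu(X_i^d) = \Theta(|X_i^d|^{-1/d})$. *)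

(* Defs.v *)
From HB Require Import structures.
From mathcomp Require Import all_boot all_order all_algebra.
From mathcomp Require Import finmap.
From mathcomp Require Import all_classical all_reals all_analysis.
From mathcomp Require Import ring lra.

Set Implicit Arguments.
Unset Strict Implicit.
Unset Printing Implicit Defensive.

Import Order.TTheory GRing.Theory Num.Theory.
Import numFieldNormedType.Exports.

Local Open Scope classical_set_scope.
Local Open Scope ring_scope.

(* The library's norm `|x| on 'rV[R]_d is the sup norm, so the Euclidean norm
   has to be introduced separately. *)
Definition enorm (R : realType) (d : nat) (x : 'rV[R]_d) : R :=
  Num.sqrt (\sum_(i < d) x 0 i ^+ 2).

Definition edist (R : realType) (d : nat) (x y : 'rV[R]_d) : R :=
  enorm (x - y).

Definition unit_ball (R : realType) (d : nat) : set 'rV[R]_d :=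
  [set x | enorm x <= 1].

(* The infimum is a minimum (lemma min_distP below) as soon as X has two
   points; otherwise inf set0 = 0 is a dummy value. *)
Definition min_dist (R : realType) (d : nat) (X : {fset 'rV[R]_d}) : R :=
  inf [set r | exists x y, [/\ x \in X, y \in X, x != y & r = edist x y]].

Definition conv_hull (R : realType) (d : nat) (A : set 'rV[R]_d) :
    set 'rV[R]_d :=
  smallest (@convex_set R 'rV[R]_d) A.

Definition extreme_points (R : realType) (d : nat) (C : set 'rV[R]_d) :
    set 'rV[R]_d :=
  [set x | C x /\
    forall (y z : 'rV[R]_d) (t : R), C y -> C z -> 0 < t < 1 ->
      x = t *: y + (1 - t) *: z -> y = x /\ z = x].

Definition vertices (R : realType) (d : nat) (X : {fset 'rV[R]_d}) :
    set 'rV[R]_d :=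
  extreme_points (conv_hull [set` X]).

Definition peel (R : realType) (d : nat) (X : {fset 'rV[R]_d}) :
    {fset 'rV[R]_d} :=
  [fset x in X | x \notin vertices X]%fset.

Section peeling_terminates.
Variables (R : realType) (d : nat).
Implicit Types (X : {fset 'rV[R]_d}) (x y z : 'rV[R]_d) (t : R).

Let sqn x : R := \sum_(i < d) x 0 i ^+ 2.

Let sqn_conv y z t : sqn (t *: y + (1 - t) *: z) =
  t * sqn y + (1 - t) * sqn z - t * (1 - t) * sqn (y - z).
Proof.
rewrite /sqn !mulr_sumr -big_split /= -sumrB; apply: eq_bigr => i _.
by rewrite !mxE; ring.
Qed.

Let sqn_ge0 x : 0 <= sqn x.
Proof. by apply: sumr_ge0 => i _; exact: sqr_ge0. Qed.

Let sqn_eq0 x : sqn x = 0 -> x = 0.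
Proof.
move=> x0; apply/rowP => i; rewrite mxE; apply/eqP; rewrite -sqrf_eq0.
exact/eqP/(psumr_eq0P (fun j _ => sqr_ge0 (x 0 j)) x0).
Qed.

Lemma peel_lt X : X != fset0 -> (#|` peel X| < #|` X|)%N.
Proof.
move=> /fset0Pn[x0 x0X].
have [x xX xmax] : exists2 x, x \in X & forall y, y \in X -> sqn y <= sqn x.
  have [x _ xmax] := @arg_maxP _ R _ [` x0X]%fset predT (fun x : X => sqn (val x)) isT.
  by exists (val x); [exact: valP | move=> y yX; exact: (xmax [` yX]%fset isT)].
have hx : conv_hull [set` X] `<=` [set y | sqn y <= sqn x].
  apply: smallest_sub; last by move=> y; exact: xmax.
  move=> y z t; rewrite !inE /= => ye ze.
  rewrite /conv /= [X in X <= _]sqn_conv.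
  have t0 : 0 <= t%:num by [].
  have t1 : 0 <= 1 - t%:num by rewrite subr_ge0.
  have := mulr_ge0 (mulr_ge0 t0 t1) (sqn_ge0 (y - z)).
  have := ler_wpM2l t0 ye; have := ler_wpM2l t1 ze; lra.
have xV : vertices X x.
  split; first exact: (@sub_gen_smallest _ _ [set` X] x xX).
  move=> y z t /hx /= ye /hx /= ze /andP[t0 t1] xE.
  have yz : y = z.
    apply/subr0_eq/sqn_eq0/eqP; rewrite eq_le sqn_ge0 andbT.
    have t1' : 0 < 1 - t by lra.
    rewrite -(pmulr_rle0 _ (mulr_gt0 t0 t1')).
    have := sqn_conv y z t; rewrite -xE.
    have := ler_wpM2l (ltW t0) ye; have := ler_wpM2l (ltW t1') ze; lra.
  by split; rewrite xE yz -scalerDl addrC subrK scale1r.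
apply: fproper_ltn_card; rewrite fproperEneq fset_sub andbT.
apply/eqP => /fsetP /(_ x); rewrite !inE /= xX /=.
by rewrite (mem_set xV).
Qed.

Lemma peeling_terminates X : exists n, iter n (@peel R d) X == fset0.
Proof.
have [n] := ubnP #|` X|; elim: n X => // n IH X Xn.
have [X0|X0] := eqVneq X fset0; first by exists 0; apply/eqP.
have [|m pm] := IH (peel X); first exact: leq_trans (peel_lt X0) Xn.
by exists m.+1; rewrite iterSr.
Qed.

Lemma min_distP X : (1 < #|` X|)%N ->
  (exists x y, [/\ x \in X, y \in X, x != y & min_dist X = edist x y]) /\
  (forall x y, x \in X -> y \in X -> x != y -> min_dist X <= edist x y).
Proof.
move=> X1; pose P (p : X * X) := p.1 != p.2.
have [p0 p0P] : exists p0, P p0.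
  have /card_gt1P[x [y [_ _ xy]]] : (1 < #|{: X}|)%N by rewrite -cardfE.
  by exists (x, y).
have [[x y] /= xy xymin] :=
  @arg_minP _ R _ p0 P (fun p : X * X => edist (val p.1) (val p.2)) p0P.
have vxy : val x != val y by rewrite val_eqE.
set S := [set r | exists x y, [/\ x \in X, y \in X, x != y & r = edist x y]].
have Slb r : S r -> edist (val x) (val y) <= r.
  by move=> [u [v [uX vX uv ->]]]; exact: (xymin ([` uX], [` vX])%fset).
have SE : min_dist X = edist (val x) (val y).
  have Sxy : S (edist (val x) (val y)).
    by exists (val x), (val y); split; rewrite ?(valP x) ?(valP y) ?SE.
  apply/eqP; rewrite eq_le; apply/andP; split.
    by apply: ge_inf => //; exists (edist (val x) (val y)).
  by apply: lb_le_inf => //; exists (edist (val x) (val y)).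
split; first by exists (val x), (val y); split; rewrite ?(valP x) ?(valP y) ?SE.
by move=> u v uX vX uv; rewrite SE; apply: Slb; exists u, v.
Qed.

End peeling_terminates.

Definition layer_number (R : realType) (d : nat) (X : {fset 'rV[R]_d}) : nat :=
  ex_minn (peeling_terminates X).

Definition evenly_distributed (R : realType) (d : nat)
    (X : nat -> {fset 'rV[R]_d}) : Prop :=
  [/\ forall i, [set` X i] `<=` @unit_ball R d,
      #|` X i|%fset @[i --> \oo] --> \oo &
      (fun i => min_dist (X i)) =Theta_\oo
        (fun i => #|` X i|%:R `^ (- (d%:R)^-1))].

(* Main.v *)
Require Import Defs.
From mathcomp Require Import all_boot all_order all_algebra finmap.
From mathcomp Require Import all_classical all_reals all_analysis.
From mathcomp Require Import zify ring lra.
Import Order.TTheory GRing.Theory Num.Theory.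
Import numFieldNormedType.Exports.
Local Open Scope classical_set_scope.
Local Open Scope ring_scope.

(* all_analysis has another [edist], which must not hide the one of Defs. *)
Import Defs.

(** The sets are built by induction on the dimension, starting from the single
    point of R^0.  With m = n^(2^d), the set X_d in R^d has about m^d points at
    mutual distance at least c/m, and its layer number is exactly
    n^(2^(d+1) - 2) = m^(2 - 2^(1-d)).  To pass from d to d+1, put q = n^(2^d)
    and take q^2 concentric spheres, at distance about 1/q^2 from each other;
    on each sphere choose a net of about q^d directions u at mutual distance
    about 1/q, and in every tangent hyperplane place a copy of X_d of diameter
    about 1/q.  The copies on the outermost sphere span disjoint facets of the
    convex hull, so they are peeled independently and simultaneously, and as
    long as they are not exhausted the remaining points, one near each
    direction of the net, have a convex hull that contains all the inner
    spheres.  Hence each of the q^2 shells takes exactly L(X_d) steps. *)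

Set Implicit Arguments.
Unset Strict Implicit.
Unset Printing Implicit Defensive.

(** * Euclidean inner product and norm *)

Section dot_product.
Variables (R : realType) (d : nat).
Implicit Types (x y z : 'rV[R]_d) (t : R).

Definition dot x y : R := \sum_(i < d) x 0 i * y 0 i.

Lemma dotC x y : dot x y = dot y x.
Proof. by apply: eq_bigr => i _; rewrite mulrC. Qed.

Lemma dotDl x y z : dot (x + y) z = dot x z + dot y z.
Proof. by rewrite -big_split; apply: eq_bigr => i _; rewrite mxE mulrDl. Qed.

Lemma dotZl t x y : dot (t *: x) y = t * dot x y.
Proof. by rewrite mulr_sumr; apply: eq_bigr => i _; rewrite mxE mulrA. Qed.

Lemma dotDr x y z : dot x (y + z) = dot x y + dot x z.
Proof. by rewrite dotC dotDl !(dotC x). Qed.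

Lemma dotZr t x y : dot x (t *: y) = t * dot x y.
Proof. by rewrite dotC dotZl dotC. Qed.

Lemma dotNl x y : dot (- x) y = - dot x y.
Proof. by rewrite -scaleN1r dotZl mulN1r. Qed.

Lemma dotNr x y : dot x (- y) = - dot x y.
Proof. by rewrite dotC dotNl dotC. Qed.

Lemma dot0l x : dot 0 x = 0.
Proof. by rewrite -(scale0r 0) dotZl mul0r. Qed.

Lemma dot0r x : dot x 0 = 0.
Proof. by rewrite dotC dot0l. Qed.

Definition dotE := (dotDl, dotDr, dotNl, dotNr, dotZl, dotZr).

Lemma dot_ge0 x : 0 <= dot x x.
Proof. by apply: sumr_ge0 => i _; rewrite -expr2 sqr_ge0. Qed.

Lemma dot_eq0 x : dot x x = 0 -> x = 0.
Proof.
move=> x0; apply/rowP => i; rewrite mxE; apply/eqP; rewrite -sqrf_eq0 expr2.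
apply/eqP/(psumr_eq0P _ x0) => // j _; rewrite -expr2; exact: sqr_ge0.
Qed.

Lemma enorm_dot x : enorm x = Num.sqrt (dot x x).
Proof. by congr Num.sqrt; apply: eq_bigr => i _; rewrite expr2. Qed.

Lemma sqr_enorm x : enorm x ^+ 2 = dot x x.
Proof. by rewrite enorm_dot sqr_sqrtr ?dot_ge0. Qed.

Lemma enorm_ge0 x : 0 <= enorm x.
Proof. exact: sqrtr_ge0. Qed.

Lemma enorm_eq0 x : enorm x = 0 -> x = 0.
Proof. by move=> x0; apply: dot_eq0; rewrite -sqr_enorm x0 expr0n. Qed.

Lemma enorm_gt0 x : x != 0 -> 0 < enorm x.
Proof.
move=> x0; rewrite lt_neqAle enorm_ge0 andbT eq_sym; apply: contraNneq x0.
by move/enorm_eq0 ->.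
Qed.

Lemma enormZ t x : enorm (t *: x) = `|t| * enorm x.
Proof.
by rewrite !enorm_dot dotZl dotZr mulrA -expr2 sqrtrM ?sqr_ge0// sqrtr_sqr.
Qed.

Lemma enormB x y : enorm (x - y) = enorm (y - x).
Proof. by rewrite -opprB -scaleN1r enormZ normrN normr1 mul1r. Qed.

Lemma edist_gt0 x y : x != y -> 0 < edist x y.
Proof. by rewrite -subr_eq0; exact: enorm_gt0. Qed.

Lemma Cauchy_Schwarz x y : dot x y <= enorm x * enorm y.
Proof.
have [->|/enorm_gt0 x0] := eqVneq x 0; first by rewrite dot0l mulr_ge0 ?enorm_ge0.
have [->|/enorm_gt0 y0] := eqVneq y 0; first by rewrite dot0r mulr_ge0 ?enorm_ge0.
have := dot_ge0 (enorm y *: x - enorm x *: y).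
have -> : dot (enorm y *: x - enorm x *: y) (enorm y *: x - enorm x *: y) =
    2 * (enorm x * enorm y) * (enorm x * enorm y - dot x y).
  by rewrite !dotE -!sqr_enorm (dotC y x); ring.
by rewrite pmulr_rge0 ?subr_ge0// !mulr_gt0.
Qed.

Lemma dot_unit u v : enorm u = 1 -> enorm v = 1 ->
  dot u v = 1 - enorm (u - v) ^+ 2 / 2.
Proof.
move=> u1 v1; rewrite sqr_enorm !dotE -!sqr_enorm u1 v1 (dotC v); by field.
Qed.

Lemma ler_enormD x y : enorm (x + y) <= enorm x + enorm y.
Proof.
rewrite -(@ler_pXn2r _ 2%N) ?nnegrE ?addr_ge0 ?enorm_ge0//.
rewrite sqr_enorm !dotE -!sqr_enorm (dotC y x).
by have := Cauchy_Schwarz x y; lra.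
Qed.

End dot_product.

(** * Convex hulls, extreme points and separation *)

Section convex_hulls.
Variables (R : realType) (d : nat).
Implicit Types (x y z p : 'rV[R]_d) (t : R) (A B : set 'rV[R]_d).

Lemma convex_setP A : @convex_set R 'rV[R]_d A <->
  (forall x y t, A x -> A y -> 0 < t < 1 -> A (t *: x + (1 - t) *: y)).
Proof.
split.
  move=> cA x y t Ax Ay /andP[t0 t1].
  have t01 : 0 <= t <= 1 by rewrite !ltW.
  have := cA x y (Itv01 (ltW t0) (ltW t1)).
  by rewrite !inE => /(_ Ax Ay).
move=> cA; apply/convex_setW => x y + + t t0 t1; rewrite !inE => Ax Ay.
by apply: (cA x y t%:num Ax Ay); rewrite t0.
Qed.

Lemma conv_hull_sub A : A `<=` conv_hull A.
Proof. exact: sub_gen_smallest. Qed.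

Lemma conv_hull_min A B :
  (forall x y t, B x -> B y -> 0 < t < 1 -> B (t *: x + (1 - t) *: y)) ->
  A `<=` B -> conv_hull A `<=` B.
Proof. by move=> /convex_setP cB; exact: smallest_sub. Qed.

Lemma conv_hull_convex A x y t : conv_hull A x -> conv_hull A y ->
  0 <= t <= 1 -> conv_hull A (t *: x + (1 - t) *: y).
Proof.
move=> Ax Ay /andP[t0 t1] B [cB AB].
have := cB x y (Itv01 t0 t1); rewrite !inE; apply; first exact: Ax.
exact: Ay.
Qed.

Lemma conv_hullS A B : A `<=` B -> conv_hull A `<=` conv_hull B.
Proof.
move=> AB; apply: conv_hull_min => [x y t Bx By /andP[/ltW t0 /ltW t1]|].
  by apply: conv_hull_convex => //; rewrite t0.
exact: subset_trans AB (@conv_hull_sub _).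
Qed.

(** A convex set stays convex when an extreme point is removed. If [x] were not in [B], the hull of
    [B] would lie in the hull of [A] without [x]. *)
Lemma extreme_in_generators A B x : extreme_points (conv_hull A) x ->
  B `<=` conv_hull A -> conv_hull B x -> B x.
Proof.
move=> [Ax xext] BA Bx; apply: contrapT => nBx.
suff /(_ x Bx)[] : conv_hull B `<=` [set y | conv_hull A y /\ y <> x] by [].
apply: conv_hull_min => [y z t [Ay yx] [Az zx] t01|y By].
  split; first by case/andP: t01 => t0 t1; apply: conv_hull_convex => //; rewrite !ltW.
  by move=> /esym/(xext _ _ _ Ay Az t01)[].
by split; [exact: BA | move=> yx; apply: nBx; rewrite -yx].
Qed.

(* The join of [z] with a compact convex set [K] is again compact and convex,
   so the hull of a finite set is compact. *)
Lemma compact_conv_hull (s : seq 'rV[R]_d) : compact (conv_hull [set` s]).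
Proof.
elim: s => [|z s IH].
  suff -> : conv_hull [set` [::]] = set0 :> set 'rV[R]_d by exact: compact0.
  by rewrite -subset0; apply: conv_hull_min.
have [s0|/set0P[y0 Ky0]] := eqVneq (conv_hull [set` s]) set0.
  suff -> : conv_hull [set` z :: s] = [set z] by exact: compact_set1.
  apply/seteqP; split => [|_ ->]; last by apply: conv_hull_sub; exact: mem_head.
  apply: conv_hull_min => [x y t -> -> _|x]; first by rewrite -scalerDl addrC subrK scale1r.
  rewrite /= inE => /predU1P[->//|xs].
  by have := @conv_hull_sub [set` s] x xs; rewrite s0.
set K := conv_hull [set` s] in IH Ky0.
pose f (u : R * 'rV[R]_d) := u.1 *: z + (1 - u.1) *: u.2.
suff -> : conv_hull [set` z :: s] = f @` (`[0, 1]%classic `*` K).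
  apply: continuous_compact; last by apply: compact_setX => //; exact: segment_compact.
  apply: continuous_subspaceT => u.
  apply: cvgD; apply: cvgZ; [exact: cvg_fst|exact: cvg_cst| |exact: cvg_snd].
  by apply: cvgB; [exact: cvg_cst|exact: cvg_fst].
apply/seteqP; split.
  apply: conv_hull_min =>
      [_ _ t [[s1 y1] [/= + Ky1] <-] [[s2 y2] [/= + Ky2] <-] /andP[t0 t1]|x].
    rewrite !in_itv /= => /andP[s10 s11] /andP[s20 s21].
    (* The total weight that the combination gives to [K]. If it vanishes, both points are [z], and
       [y0] serves as a dummy partner of weight 0. *)
    set r := t * (1 - s1) + (1 - t) * (1 - s2).
    have a0 : 0 <= t * (1 - s1) by rewrite mulr_ge0 ?subr_ge0// ltW.
    have b0 : 0 <= (1 - t) * (1 - s2) by rewrite mulr_ge0 ?subr_ge0// ltW.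
    have r0 : 0 <= r by exact: addr_ge0.
    have c0 : 0 <= t * s1 by rewrite mulr_ge0 // ltW.
    have d0 : 0 <= (1 - t) * s2 by rewrite mulr_ge0 ?subr_ge0// ltW.
    have [r_eq0|rn0] := eqVneq r 0.
      have /andP[/eqP A0 /eqP B0] : (t * (1 - s1) == 0) && ((1 - t) * (1 - s2) == 0).
        by rewrite -paddr_eq0//; exact/eqP.
      exists (1, y0); first by split=> //=; rewrite in_itv/= ler01 lexx.
      rewrite /f /= subrr scale0r addr0 !scalerDr !scalerA A0 B0 !scale0r !addr0.
      by rewrite -scalerDl scale1r -[LHS]scale1r; congr (_ *: _); move: r_eq0; rewrite /r; lra.
    exists (1 - r, (t * (1 - s1) / r) *: y1 + (1 - (t * (1 - s1) / r)) *: y2).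
      split => /=; first by rewrite in_itv /= /r; apply/andP; split; nra.
      apply: conv_hull_convex => //; rewrite divr_ge0//= ler_pdivrMr ?mul1r ?lerDl//.
      by rewrite lt_neqAle eq_sym rn0.
    rewrite /f /=; apply/rowP => i; rewrite !mxE; move: rn0; rewrite /r => rn0; field.
    exact: rn0.
  rewrite /= inE => /predU1P[->|xs].
    exists (1, y0); first by split=> //=; rewrite in_itv/= ler01 lexx.
    by rewrite /f /= subrr scale0r addr0 scale1r.
  exists (0, x); first by split=> /=; [rewrite in_itv/= ler01 lexx|exact: conv_hull_sub].
  by rewrite /f /= subr0 scale0r add0r scale1r.
move=> _ [[t y] [/= + Ky] <-]; rewrite in_itv /= => t01.
apply: conv_hull_convex => //; first by apply: conv_hull_sub; exact: mem_head.
by apply: conv_hullS Ky => x xs; rewrite /= inE; apply/orP; right.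
Qed.

Lemma sqr_dist_continuous p :
  continuous (fun y : 'rV[R]_d => dot (y - p) (y - p) : R).
Proof.
have coord i : continuous (fun y : 'rV[R]_d => (y - p) 0 i : R).
  move=> y; rewrite (_ : (fun z : 'rV[R]_d => _) = (fun z => z 0 i - p 0 i)); last first.
    by apply/funext => z; rewrite !mxE.
  apply: (@continuousB _ _ _ (fun z : 'rV[R]_d => z 0 i) (fun=> p 0 i)).
    exact: coord_continuous.
  exact: cst_continuous.
rewrite /dot; apply: (continuous_big (op := +%R)) => [u|i _ y]; first exact: add_continuous.
exact: continuousM (coord i y) (coord i y).
Qed.

(* A separating direction at [p] is [p - y], [y] the point of the hull nearest to [p]. *)
Lemma in_conv_hull_seq (s : seq 'rV[R]_d) p :
  (forall w, exists2 z, z \in s & dot p w <= dot z w) -> conv_hull [set` s] p.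
Proof.
move=> H; have [z0 z0s _] := H 0.
pose f y := dot (y - p) (y - p).
have [||y] := @compact_EVT_min _ R f _ _ (@compact_conv_hull s).
- by exists z0; exact: conv_hull_sub.
- by apply: continuous_subspaceT; exact: sqr_dist_continuous.
rewrite inE => Ky ymin.
have [z zs zw] := H (p - y).
suff /dot_eq0/subr0_eq <- : dot (y - p) (y - p) = 0 by [].
have Kz : conv_hull [set` s] z by exact: conv_hull_sub.
set A := dot (y - p) (y - p).
have A0 : 0 <= A by exact: dot_ge0.
pose B := dot (z - y) (z - y); have B0 : 0 <= B by exact: dot_ge0.
pose C := dot (z - y) (y - p).
have CA : C <= - A by move: zw; rewrite /C /A !dotE !(dotC y) (dotC z p); lra.
(* Minimality of the distance at [y], tested along the segment from [y] to [z]. *)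
have Q t : 0 <= t <= 1 -> 0 <= t * (2 * C + t * B).
  move=> t01; have := ymin (t *: z + (1 - t) *: y).
  rewrite inE => /(_ (conv_hull_convex Kz Ky t01)).
  have -> : f (t *: z + (1 - t) *: y) = A + t * (2 * C + t * B).
    rewrite /f /A /B /C; have -> : t *: z + (1 - t) *: y - p = t *: (z - y) + (y - p).
      by apply/rowP => i; rewrite !mxE; ring.
    move: (z - y) (y - p) => v u; rewrite !dotE (dotC u v); ring.
  by rewrite /f -/A; lra.
apply/eqP; rewrite eq_le A0 andbT leNgt; apply/negP => Apos.
(* With [C <= - A], this [t] gives [2 * C + t * B <= - A < 0], against [Q]. *)
pose t := A / (A + B).
have AB : 0 < A + B by lra.
have tE : t * (A + B) = A by rewrite /t divfK ?gt_eqF.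
have t0 : 0 < t by rewrite /t divr_gt0.
have t1 : t <= 1 by rewrite /t ler_pdivrMr//; lra.
have := Q t; rewrite (ltW t0) t1 => /(_ isT); rewrite pmulr_rge0//; nra.
Qed.

End convex_hulls.

(** * Iterated peeling, and vertices inside the hull or on a face *)

Section layer_numbers.
Variables (R : realType) (d : nat).
Implicit Types X Y : {fset 'rV[R]_d}.

Lemma peel_sub X : (peel X `<=` X)%fset.
Proof. exact: fset_sub. Qed.

Lemma mem_peel X x : x \in peel X <-> x \in X /\ ~ vertices X x.
Proof.
rewrite !inE /=; split.
  by move=> /andP[xX /negP xV]; split=> // /mem_set.
by move=> [-> xV]; apply/negP; rewrite inE.
Qed.

Lemma iter_peel_sub n X : (iter n (@peel R d) X `<=` X)%fset.
Proof.
elim: n => [|n IH] /=; first exact: fsubset_refl.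
exact: fsubset_trans (peel_sub _) IH.
Qed.

Lemma iter_layer_number X : iter (layer_number X) (@peel R d) X = fset0.
Proof. by rewrite /layer_number; case: ex_minnP => n /eqP. Qed.

Lemma iter_peel_neq0 n X : (n < layer_number X)%N ->
  iter n (@peel R d) X != fset0.
Proof.
rewrite /layer_number; case: ex_minnP => m _ mmin; apply: contraTneq => /eqP/mmin.
by rewrite -leqNgt.
Qed.

Lemma layer_number_le n X : iter n (@peel R d) X = fset0 ->
  (layer_number X <= n)%N.
Proof. by move=> /eqP; rewrite /layer_number; case: ex_minnP => m _; exact. Qed.

(** Turns an identity between iterated peelings into a sum of layer numbers. The earlier iterates
    have to be nonempty, since idle steps on the empty set do not count. *)
Lemma layer_number_iter n X :
  (forall m, (m < n)%N -> iter m (@peel R d) X != fset0) ->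
  layer_number X = (n + layer_number (iter n (@peel R d) X))%N.
Proof.
move=> Xn; apply/eqP; rewrite eqn_leq; apply/andP; split.
  by apply: layer_number_le; rewrite addnC iterD iter_layer_number.
have nX : (n <= layer_number X)%N.
  rewrite leqNgt; apply/negP => /Xn.
  by rewrite iter_layer_number eqxx.
rewrite -leq_subRL// layer_number_le// -iterD subnK//.
exact: iter_layer_number.
Qed.

Lemma layer_number0 : layer_number (fset0 : {fset 'rV[R]_d}) = 0%N.
Proof. by apply/eqP; rewrite -leqn0 layer_number_le. Qed.

(** The support condition puts [p] in the hull of [s]; an extreme point of the larger hull lying
    there would belong to [s]. This protects the inner shells during peeling. *)
Lemma vertices_interior X (s : seq 'rV[R]_d) p : {subset s <= X} -> p \notin s ->
  (forall w, exists2 z, z \in s & dot p w <= dot z w) -> ~ vertices X p.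
Proof.
move=> sX ps /in_conv_hull_seq sp pX; move/negP: ps; apply.
by apply: (extreme_in_generators pX _ sp) => x /sX xX; exact: conv_hull_sub.
Qed.

End layer_numbers.

(** The hyperplane at height [r] over [u] bounds the hull of [Z] and cuts from it the face [f] (hull
    of [X]). The extreme points of a face are the extreme points of the whole hull that lie on
    it. *)
Lemma vertices_face (R : realType) (d D : nat) (X : {fset 'rV[R]_d})
    (Z : {fset 'rV[R]_D}) (f : 'rV[R]_d -> 'rV[R]_D) u r :
  (forall x y t, f (t *: x + (1 - t) *: y) = t *: f x + (1 - t) *: f y) ->
  injective f -> (forall x, dot (f x) u = r) ->
  (forall x, x \in X -> f x \in Z) ->
  (forall p, p \in Z -> dot p u < r \/ exists2 x, x \in X & p = f x) ->
  forall x, vertices Z (f x) <-> vertices X x.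
Proof.
move=> faff finj fr fZ Zf x.
have hullf y : conv_hull [set` X] y -> conv_hull [set` Z] (f y).
  move: y; apply: (@conv_hull_min _ _ _ [set y | conv_hull [set` Z] (f y)])
      => [y z t /= yZ zZ /andP[t0 t1]|y yX].
    by rewrite faff; apply: conv_hull_convex => //; rewrite !ltW.
  by apply: conv_hull_sub; exact: fZ.
(* The right-hand side describes a convex set: mixing anything in it with a strictly lower point
   stays strictly below [r]. *)
have hullZ p : conv_hull [set` Z] p ->
    dot p u < r \/ exists2 x, conv_hull [set` X] x & p = f x.
  move: p; apply: (@conv_hull_min _ _ _ [set p | dot p u < r \/
      exists2 x, conv_hull [set` X] x & p = f x]) => [y z t /= yZ zZ /andP[t0 t1]|p]; last first.
    move=> /Zf[pr|[y yX ->]]; first by left.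
    by right; exists y => //; exact: conv_hull_sub.
  have t1' : 0 < 1 - t by rewrite subr_gt0.
  case: yZ => [yr|[y' Xy' ->]].
    left; have {zZ}zr : dot z u <= r by case: zZ => [/ltW//|[z' _ ->]]; rewrite fr.
    by rewrite !dotE; nra.
  case: zZ => [zr|[z' Xz' ->]]; first by left; rewrite !dotE fr; nra.
  right; exists (t *: y' + (1 - t) *: z'); last by rewrite faff.
  by apply: conv_hull_convex => //; rewrite !ltW.
have hullr p : conv_hull [set` Z] p -> dot p u <= r.
  by move=> /hullZ[/ltW//|[y _ ->]]; rewrite fr.
have faceZ p : conv_hull [set` Z] p -> dot p u = r ->
    exists2 x, conv_hull [set` X] x & p = f x.
  by move=> /hullZ[|//] + pr; rewrite pr ltxx.
split=> [[Zx xext]|[Xx xext]].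
  split.
    by have [y Xy /finj ->] := faceZ _ Zx (fr x).
  move=> y z t /hullf Xy /hullf Xz t01 xE.
  by have [|/finj -> /finj ->] := xext _ _ _ Xy Xz t01; first by rewrite xE faff.
split; first exact: hullf.
move=> y z t Zy Zz /[dup] t01 /andP[t0 t1] xE.
have t1' : 0 < 1 - t by rewrite subr_gt0.
have := congr1 (fun p => dot p u) xE; rewrite /= !dotE fr => rE.
have yr := hullr _ Zy; have zr := hullr _ Zz.
(* Neither [y] nor [z] exceeds height [r], but their mixture attains it, so both lie on the face. *)
have yrE : dot y u = r by nra.
have zrE : dot z u = r by nra.
have [y' Xy' yE] := faceZ _ Zy yrE.
have [z' Xz' zE] := faceZ _ Zz zrE.
have [|yx zx] := xext _ _ _ Xy' Xz' t01; first by apply: finj; rewrite faff -yE -zE.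
by rewrite yE zE yx zx.
Qed.

(** * Copies of a set in tangent hyperplanes of a sphere *)

Section tangent_discs.
Variables (R : realType) (d : nat).
Implicit Types (x y : 'rV[R]_d) (u v w : 'rV[R]_d.+1) (t r a : R).

Definition extend0 x : 'rV[R]_d.+1 :=
  \row_j oapp (fun i => x 0 i) 0 (unlift 0 j).

Let e0 : 'rV[R]_d.+1 := delta_mx 0 0.

(* The reflection exchanging [e0] and the unit vector [u] maps the coordinate
   hyperplane orthogonal to [e0] onto the hyperplane orthogonal to [u];
   if [u = e0] the division by 0 yields the identity. *)
Definition tangent u x : 'rV[R]_d.+1 :=
  extend0 x - (2 * dot (extend0 x) (u - e0) / dot (u - e0) (u - e0)) *: (u - e0).

Lemma dot_extend0 x y : dot (extend0 x) (extend0 y) = dot x y.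
Proof.
rewrite /dot big_ord_recl !mxE unlift_none /= mul0r add0r.
by apply: eq_bigr => i _; rewrite !mxE liftK.
Qed.

Lemma dot_e0 v : dot v e0 = v 0 0.
Proof.
rewrite /dot big_ord_recl !mxE !eqxx mulr1 big1 ?addr0// => i _.
by rewrite !mxE eqxx /= mulr0.
Qed.

Lemma dot_extend0_e0 x : dot (extend0 x) e0 = 0.
Proof. by rewrite dot_e0 mxE unlift_none. Qed.

Lemma extend0_linear x y t s : extend0 (t *: x + s *: y) = t *: extend0 x + s *: extend0 y.
Proof.
apply/rowP => i; rewrite !mxE; case: unliftP => [j _|_] /=; first by rewrite !mxE.
by rewrite !mulr0 addr0.
Qed.

Lemma tangent_linear u x y t s :
  tangent u (t *: x + s *: y) = t *: tangent u x + s *: tangent u y.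
Proof.
rewrite /tangent extend0_linear !(dotDl (t *: extend0 x)) !dotZl.
by apply/rowP => i; rewrite !mxE; ring.
Qed.

Lemma dot_tangent u x y : dot (tangent u x) (tangent u y) = dot x y.
Proof.
rewrite /tangent -dot_extend0; move: (extend0 x) (extend0 y) (u - e0) => p q w.
have [->|w0] := eqVneq w 0; first by rewrite !scaler0 !subr0.
have ww : dot w w != 0 by apply: contra_neq w0 => /dot_eq0.
by rewrite !dotE !(dotC w q); field.
Qed.

Lemma enorm_tangent u x : enorm (tangent u x) = enorm x.
Proof. by rewrite !enorm_dot dot_tangent. Qed.

Lemma tangentB u x y : tangent u x - tangent u y = tangent u (x - y).
Proof.
have := tangent_linear u x y 1 (-1); rewrite !scale1r !scaleN1r => ->.
by [].
Qed.

Lemma dot_tangent_normal u x : enorm u = 1 -> dot (tangent u x) u = 0.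
Proof.
move=> u1.
have uu : dot u u = 1 by rewrite -sqr_enorm u1 expr1n.
have ee : dot e0 e0 = 1 by rewrite dot_e0 mxE !eqxx.
have [ue|ue] := eqVneq u e0.
  by rewrite /tangent ue subrr scaler0 subr0 dot_extend0_e0.
have ww : dot (u - e0) (u - e0) != 0.
  by move: ue; rewrite -subr_eq0; apply: contra_neq => /dot_eq0.
move: ww; rewrite /tangent !dotE dot_extend0_e0 uu ee (dotC e0 u) opprK => ww; field.
exact: ww.
Qed.

(** For a unit vector [u], the copy scaled by [a] in the hyperplane that touches the sphere of
    radius [r] at [r *: u]. *)
Definition place r a u x := r *: u + a *: tangent u x.

Lemma place_affine r a u x y t :
  place r a u (t *: x + (1 - t) *: y) = t *: place r a u x + (1 - t) *: place r a u y.
Proof. by rewrite /place tangent_linear; apply/rowP => i; rewrite !mxE; ring. Qed.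

Lemma placeB r a u x y : place r a u x - place r a u y = a *: tangent u (x - y).
Proof. by rewrite /place -tangentB opprD addrACA subrr add0r -scalerBr. Qed.

Lemma edist_place r a u x y : 0 <= a ->
  edist (place r a u x) (place r a u y) = a * edist x y.
Proof. by move=> a0; rewrite /edist placeB enormZ ger0_norm// enorm_tangent. Qed.

Lemma place_inj r a u : 0 < a -> injective (place r a u).
Proof.
move=> a0 x y xy; apply/eqP/negPn/negP => /edist_gt0.
rewrite -(pmulr_rgt0 _ a0) -(edist_place r u) ?ltW// xy.
by rewrite /edist subrr enorm_dot dot0l sqrtr0 ltxx.
Qed.

Lemma dot_place r a u x : enorm u = 1 -> dot (place r a u x) u = r.
Proof.
move=> u1; rewrite /place dotDl !dotZl dot_tangent_normal//.
by rewrite -sqr_enorm u1 expr1n mulr0 mulr1 addr0.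
Qed.

Lemma sqr_enorm_place r a u x : enorm u = 1 ->
  enorm (place r a u x) ^+ 2 = r ^+ 2 + a ^+ 2 * enorm x ^+ 2.
Proof.
move=> u1; have := dot_tangent_normal x u1; have := dot_tangent u x x.
rewrite (sqr_enorm (place _ _ _ _)) /place; move: (tangent u x) => v vv vu.
by rewrite !dotE (dotC u v) vv vu -!sqr_enorm u1; ring.
Qed.

Definition shell r a (U : {fset 'rV[R]_d.+1}) (X : {fset 'rV[R]_d}) :=
  [fset p in [seq place r a u x | u <- U, x <- X]]%fset.

Lemma shellP r a (U : {fset 'rV[R]_d.+1}) (X : {fset 'rV[R]_d}) p :
  p \in shell r a U X <-> exists u x, [/\ u \in U, x \in X & p = place r a u x].
Proof.
rewrite inE; split.
  by move=> /allpairsP[[u x] /= [uU xX ->]]; exists u, x.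
by move=> [u [x [uU xX ->]]]; apply/allpairsP; exists (u, x).
Qed.

(** * Peeling one shell around an inner set *)

Section peel_shell.
Variables (r a rho : R) (U : {fset 'rV[R]_d.+1}) (A : {fset 'rV[R]_d.+1}).
Variable X : {fset 'rV[R]_d}.
Hypotheses (a0 : 0 < a) (rho_r : rho <= r).
Hypothesis U1 : forall u, u \in U -> enorm u = 1.
Hypothesis facets : forall u v x, u \in U -> v \in U -> u != v -> x \in X ->
  dot (place r a v x) u < r.
Hypothesis A_rho : forall p, p \in A -> enorm p < rho.
Hypothesis cover : forall w, enorm w = 1 ->
  exists2 u, u \in U & forall x, x \in X -> rho <= dot (place r a u x) w.

(** By [facets], the hyperplane at height [r] over [u] meets the hull exactly in the hull of the
    copy at [u], so [vertices_face] treats each copy separately. By [cover], a nonempty [W] leaves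
    in every direction a point at height at least [rho], beyond all of [A], so [A] stays
    interior. *)
Lemma peel_shell (W : {fset 'rV[R]_d}) : (W `<=` X)%fset -> W != fset0 ->
  peel (shell r a U W `|` A)%fset = (shell r a U (peel W) `|` A)%fset.
Proof.
move=> /fsubsetP WX /fset0Pn[x0 x0W]; set Z := (_ `|` A)%fset.
have ltA p u : p \in A -> u \in U -> dot p u < r.
  move=> /A_rho pA /U1 u1; apply: le_lt_trans (lt_le_trans pA rho_r).
  by apply: le_trans (Cauchy_Schwarz _ _) _; rewrite u1 mulr1.
have vert u x : u \in U -> vertices Z (place r a u x) <-> vertices W x.
  move=> uU; apply: (vertices_face (u := u) (r := r)).
  - exact: place_affine.
  - exact: place_inj.
  - by move=> y; rewrite dot_place ?U1.
  - by move=> y yW; rewrite inE; apply/orP; left; apply/shellP; exists u, y.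
  - move=> p; rewrite inE => /orP[/shellP[v [y [vU yW ->]]]|pA].
      have [->|uv] := eqVneq v u; first by right; exists y.
      by left; apply: facets; rewrite ?WX// eq_sym.
    by left; exact: ltA.
have inner p : p \in A -> ~ vertices Z p.
  move=> pA; apply: (@vertices_interior _ _ _ (shell r a U W)).
  - by move=> z zW; rewrite inE zW.
  - apply/negP => /shellP[u [x [uU xW pE]]]; have := ltA _ _ pA uU.
    by rewrite pE dot_place ?U1// ltxx.
  move=> w; have [->|w0] := eqVneq w 0.
    have [|u uU _] := cover (w := e0).
      by rewrite enorm_dot dot_e0 mxE !eqxx sqrtr1.
    exists (place r a u x0); last by rewrite !dot0r.
    by apply/shellP; exists u, x0.
  have w0' := enorm_gt0 w0.
  have [|u uU ux] := cover (w := (enorm w)^-1 *: w).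
    by rewrite enormZ ger0_norm ?invr_ge0 ?enorm_ge0// mulVf ?gt_eqF.
  exists (place r a u x0); first by apply/shellP; exists u, x0.
  apply: le_trans (Cauchy_Schwarz _ _) _.
  have := ux _ (WX _ x0W); rewrite dotZr mulrC ler_pdivlMr// => /(le_trans _); apply.
  by rewrite ler_pM2r// ltW// A_rho.
apply/fsetP => p; apply/idP/idP.
  move=> /mem_peel[]; rewrite inE => /orP[/shellP[u [x [uU xW ->]]]|pA] pV; last first.
    by rewrite inE pA orbT.
  rewrite inE; apply/orP; left; apply/shellP; exists u, x; split=> //.
  by apply/mem_peel; split=> //; rewrite -(vert u).
rewrite inE => /orP[/shellP[u [x [uU /mem_peel[xW xV] ->]]]|pA]; apply/mem_peel.
  split; last by rewrite (vert u).
  by rewrite inE; apply/orP; left; apply/shellP; exists u, x.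
by split; [rewrite inE pA orbT | exact: inner].
Qed.

(** As long as the copies of [X] survive, peeling acts only on them, in all copies at once; when
    they are exhausted, exactly [A] is left. *)
Lemma layer_number_shell :
  layer_number (shell r a U X `|` A)%fset = (layer_number X + layer_number A)%N.
Proof.
have itX n : (n <= layer_number X)%N -> iter n (@peel R d.+1) (shell r a U X `|` A)%fset =
    (shell r a U (iter n (@peel R d) X) `|` A)%fset.
  elim: n => //= n IH nX; rewrite IH ?(ltnW nX)// peel_shell//.
    exact: iter_peel_sub.
  exact: iter_peel_neq0.
rewrite (@layer_number_iter _ _ (layer_number X)).
  rewrite itX// iter_layer_number; congr (_ + layer_number _)%N.
  apply/fsetP => p; rewrite inE orb_idl// => /shellP[u [x [_]]].
  by rewrite inE.
move=> m mX; rewrite itX ?(ltnW mX)//.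
have /fset0Pn[x xX] := iter_peel_neq0 mX.
have [|u uU _] := cover (w := e0).
  by rewrite enorm_dot dot_e0 mxE !eqxx sqrtr1.
apply/fset0Pn; exists (place r a u x).
by rewrite inE; apply/orP; left; apply/shellP; exists u, x.
Qed.

End peel_shell.

End tangent_discs.

(** * Nets on the unit sphere from lattice points on a cube *)

Section sphere_net.
Variables (R : realType) (d : nat).
Implicit Types (g h z w : 'rV[R]_d.+1).

Lemma ler_coord_enorm (n : nat) (z : 'rV[R]_n) i : `|z 0 i| <= enorm z.
Proof.
rewrite -sqrtr_sqr ler_wsqrtr// (bigD1 i)//= lerDl sumr_ge0// => j _.
exact: sqr_ge0.
Qed.

Lemma enorm_le_coord (n : nat) (z : 'rV[R]_n) (b : R) : (forall i, `|z 0 i| <= b) ->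
  enorm z <= n%:R * b.
Proof.
case: n z => [|n] z zb; first by rewrite /enorm big_ord0 sqrtr0 mul0r.
have b0 : 0 <= b by apply: le_trans (zb 0); exact: normr_ge0.
rewrite -(@ler_pXn2r _ 2%N) ?nnegrE ?enorm_ge0 ?mulr_ge0//.
rewrite sqr_sqrtr ?sumr_ge0//; last by move=> i _; exact: sqr_ge0.
apply: (@le_trans _ _ (\sum_(i < n.+1) b ^+ 2)).
  by apply: ler_sum => i _; rewrite -real_normK ?num_real// lerXn2r ?nnegrE.
rewrite sumr_const card_ord exprMn -[leLHS]mulr_natl ler_wpM2r ?sqr_ge0//.
by rewrite -natrX ler_nat expnS leq_pmulr.
Qed.

Definition normalize z := (enorm z)^-1 *: z.

Lemma enorm_normalize z : z != 0 -> enorm (normalize z) = 1.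
Proof.
move=> /enorm_gt0 z0.
by rewrite enormZ ger0_norm ?invr_ge0 ?enorm_ge0// mulVf ?gt_eqF.
Qed.

(** Changing the vector and changing the scaling factor each cost at most
    [enorm (z - g) / enorm z]. *)
Lemma normalize_dist z g : z != 0 -> g != 0 ->
  enorm (normalize z - normalize g) <= 2 * enorm (z - g) / enorm z.
Proof.
move=> /enorm_gt0 z0 /enorm_gt0 g0.
have -> : normalize z - normalize g =
    (enorm z)^-1 *: (z - g) + ((enorm z)^-1 - (enorm g)^-1) *: g.
  by apply/rowP => i; rewrite !mxE; ring.
apply: le_trans (ler_enormD _ _) _; rewrite !enormZ.
have -> : `|(enorm z)^-1 - (enorm g)^-1| * enorm g = `|enorm g - enorm z| / enorm z.
  rewrite -[X in _ * X = _]gtr0_norm// -normrM -[X in _ = _ / X]gtr0_norm// -normfV -normrM.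
  by congr `|_|; field; rewrite !gt_eqF.
rewrite gtr0_norm ?invr_gt0// mulrC -mulrDl ler_pM2r ?invr_gt0//.
suff : `|enorm g - enorm z| <= enorm (z - g) by lra.
have H1 := ler_enormD (z - g) g; have H2 := ler_enormD (g - z) z.
rewrite !subrK (enormB g) in H1 H2; rewrite ler_norml; apply/andP; split; lra.
Qed.

Variable M : nat.
Hypothesis M0 : (0 < M)%N.

(** Lattice points on the boundary of the cube [[-M, M]^(d+1)]; the net consists of their radial
    projections. *)
Definition cube_point g :=
  [/\ forall i, g 0 i \is a Num.int, forall i, `|g 0 i| <= M%:R &
      exists k, `|g 0 k| = M%:R].

Let M0' : 0 < M%:R :> R. Proof. by rewrite ltr0n. Qed.

Lemma cube_point_ge g : cube_point g -> M%:R <= enorm g.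
Proof. by case=> _ _ [k <-]; exact: ler_coord_enorm. Qed.

Lemma cube_point_neq0 g : cube_point g -> g != 0.
Proof.
move=> /cube_point_ge gM; apply: contraTneq (lt_le_trans M0' gM) => ->.
by rewrite enorm_dot dot0l sqrtr0 ltxx.
Qed.

Lemma cube_point_sep g h : cube_point g -> cube_point h -> g != h ->
  (2 * d.+1%:R * M%:R)^-1 <= enorm (normalize g - normalize h).
Proof.
wlog gh : g h / enorm g <= enorm h.
  move=> H Cg Ch gh; have [gh'|/ltW hg] := leP (enorm g) (enorm h); first exact: H.
  by rewrite enormB; apply: H => //; rewrite eq_sym.
move=> Cg Ch gneh.
have [gint gM [k gk]] := Cg; have [hint hM _] := Ch.
have g0 := lt_le_trans M0' (cube_point_ge Cg).
have h0 := lt_le_trans M0' (cube_point_ge Ch).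
have [i gi] : exists i, g 0 i != h 0 i.
  apply/existsP; rewrite -negb_forall; apply: contra gneh => /forallP H.
  by apply/eqP/rowP => i; exact/eqP.
have gi1 : 1 <= `|g 0 i - h 0 i|.
  by rewrite norm_intr_ge1 ?subr_eq0 ?rpredB.
(* The face coordinate [k] of [g] bounds the difference of the scaling factors
   [1/|g|] and [1/|h|]; the coordinate [i], where [g] and [h] differ, does the rest. *)
set e := enorm _.
have Hk := ler_coord_enorm (normalize g - normalize h) k.
have Hi := ler_coord_enorm (normalize g - normalize h) i.
rewrite !mxE -/e in Hk Hi.
set x := (enorm g)^-1 in Hk Hi; set y := (enorm h)^-1 in Hk Hi.
have x0 : 0 < x by rewrite invr_gt0.
have yx : 0 <= x - y by rewrite subr_ge0 lef_pV2.
have y0 : 0 < y by rewrite invr_gt0.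
have ek : (x - y) * M%:R <= e.
  apply: le_trans Hk; apply: le_trans (lerB_dist _ _).
  by rewrite !normrM gk (gtr0_norm x0) (gtr0_norm y0) mulrBl lerB// ler_wpM2l// ltW.
have ei : x <= 2 * e.
  have le_e : x * `|g 0 i - h 0 i| <= e + (x - y) * M%:R.
    rewrite -[X in X * _](gtr0_norm x0) -normrM.
    have -> : x * (g 0 i - h 0 i) = (x * g 0 i - y * h 0 i) - (x - y) * h 0 i by ring.
    apply: le_trans (ler_normB _ _) _; apply: lerD => //.
    by rewrite normrM ger0_norm// ler_wpM2l.
  have le_x := ler_peMr (ltW x0) gi1.
  apply: (le_trans (le_trans le_x le_e)).
  by rewrite mulr_natl mulr2n lerD2l.
have xM : (d.+1%:R * M%:R)^-1 <= x.
  by rewrite lef_pV2 ?posrE ?mulr_gt0// enorm_le_coord.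
by rewrite -mulrA invfM mulrC ler_pdivrMr// [e * _]mulrC; exact: le_trans xM ei.
Qed.

Lemma cube_point_dense w : enorm w = 1 ->
  exists2 g, cube_point g & enorm (normalize g - w) <= 2 * d.+1%:R / M%:R.
Proof.
move=> w1.
have [k _ kmax] := @arg_maxP _ R _ ord0 predT (fun i => `|w 0 i|) isT.
have wk0 : 0 < `|w 0 k|.
  rewrite lt_neqAle normr_ge0 andbT eq_sym; apply/eqP => wk.
  have : enorm w <= d.+1%:R * 0.
    by apply: enorm_le_coord => i; rewrite -wk; exact: kmax.
  by rewrite w1 mulr0 ler10.
(* This scaling pushes [w] to the boundary of the cube. Rounding down then fixes coordinate [k],
   which is already [M] or [-M], so [g] stays on the boundary. *)
pose c := M%:R / `|w 0 k|; have c0 : 0 < c by rewrite divr_gt0.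
pose z := c *: w; pose g : 'rV[R]_d.+1 := \row_i (Num.floor (z 0 i))%:~R.
have zM i : `|z 0 i| <= M%:R.
  rewrite mxE normrM gtr0_norm// /c mulrAC -mulrA ler_piMr//.
  by rewrite ler_pdivrMr// mul1r; exact: kmax.
have zk : `|z 0 k| = M%:R by rewrite mxE normrM gtr0_norm// divfK// gt_eqF.
have Cg : cube_point g.
  split.
  - by move=> i; rewrite mxE intr_int.
  - move=> i; rewrite mxE; have := zM i; rewrite !ler_norml => /andP[zi1 zi2].
    apply/andP; split; last by apply: le_trans zi2; exact: floor_le.
    have -> : - M%:R = (- (M%:Z))%:~R :> R by rewrite rmorphN.
    by rewrite ler_int floor_ge_int rmorphN.
  - exists k; rewrite mxE -zk; congr `|_|; apply: floorK.
    move: zk; case: (ger0P (z 0 k)) => _ zk; first by rewrite zk natr_int.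
    by rewrite -[z 0 k]opprK rpredN zk natr_int.
exists g => //.
have zE : enorm z = c by rewrite enormZ w1 gtr0_norm// mulr1.
have z0 : z != 0.
  by apply: contraTneq c0 => z0; rewrite -zE z0 enorm_dot dot0l sqrtr0 ltxx.
have -> : w = normalize z by rewrite /normalize zE /z scalerA mulVf ?scale1r ?gt_eqF.
rewrite enormB; apply: le_trans (normalize_dist z0 (cube_point_neq0 Cg)) _.
rewrite zE -!mulrA ler_pM2l//; apply: ler_pM; rewrite ?enorm_ge0 ?invr_ge0 ?(ltW c0)//.
  rewrite -[leRHS]mulr1; apply: enorm_le_coord => i; rewrite !mxE.
  have /andP[] := floor_itv ((c *: w) 0 i).
  rewrite !mxE intrD ler_norml => H1 H2; apply/andP; split; lra.
rewrite lef_pV2 ?posrE// /c ler_peMr// invf_ge1//.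
by rewrite -w1 ler_coord_enorm.
Qed.

(** Codes for cube points: the axis of a facet, its sign, and the other coordinates shifted by [M]
    to be nonnegative. A point on several facets has several codes, so the size of [J] only bounds
    the net from above. *)
Let J : finType := ('I_d.+1 * bool * {ffun 'I_d -> 'I_(2 * M).+1})%type.

Let cube_of (j : J) : 'rV[R]_d.+1 :=
  \row_i (if unlift j.1.1 i is Some i' then (j.2 i')%:R - M%:R
          else if j.1.2 then M%:R else - M%:R).

Let cube_ofP j : cube_point (cube_of j).
Proof.
split.
- move=> i; rewrite mxE; case: unlift => [i'|]; first by rewrite rpredB ?natr_int.
  by case: ifP => _; rewrite ?rpredN natr_int.
- move=> i; rewrite mxE; case: unlift => [i'|].
    have := ltn_ord (j.2 i'); rewrite ltnS -(ler_nat R) natrM => H.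
    have := ler0n R (j.2 i'); rewrite ler_norml; lra.
  by case: ifP => _; rewrite ?normrN normr_nat.
- exists j.1.1; rewrite mxE unlift_none.
  by case: ifP => _; rewrite ?normrN normr_nat.
Qed.

Let cube_of_surj g : cube_point g -> exists j, g = cube_of j.
Proof.
move=> [gint gM [k gk]].
have gnat i : g 0 i + M%:R \is a Num.nat.
  rewrite natrEint rpredD ?natr_int//=.
  by have := gM i; rewrite ler_norml; lra.
exists (k, 0 <= g 0 k, [ffun i => inord (Num.truncn (g 0 (lift k i) + M%:R))]).
apply/rowP => i; rewrite mxE /=; case: unliftP => [i' ->|->].
  rewrite ffunE inordK ?truncnK ?addrK// ltnS -(ler_nat R) truncnK//.
  by rewrite natrM; have := gM (lift k i'); rewrite ler_norml; lra.
by move: gk; case: (ger0P (g 0 k)) => _ <-//; rewrite opprK.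
Qed.

Lemma cube_net : exists U : {fset 'rV[R]_d.+1}, [/\
  forall u, u \in U <-> exists2 g, cube_point g & u = normalize g,
  ((2 * M).+1 ^ d <= #|` U|)%N &
  (#|` U| <= d.+1 * 2 * (2 * M).+1 ^ d)%N].
Proof.
pose s := [seq normalize (cube_of j) | j : J].
exists [fset u in s]%fset; split.
- move=> u; rewrite !inE; split.
    by move=> /mapP[j _ ->]; exists (cube_of j).
  by move=> [g /cube_of_surj[j ->] ->]; apply/mapP; exists j; rewrite ?mem_enum.
- rewrite card_fseq.
  (* One facet already yields enough points; [cube_point_sep] keeps their projections distinct. *)
  pose s' := [seq normalize (cube_of (ord0, true, f)) | f : {ffun 'I_d -> 'I_(2 * M).+1}].
  have s'_uniq : uniq s'.
    rewrite map_inj_uniq ?enum_uniq// => f f' ff'.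
    have /eqP/rowP ff : cube_of (ord0, true, f) == cube_of (ord0, true, f').
      apply/negPn/negP => /(cube_point_sep (cube_ofP _) (cube_ofP _)).
      rewrite ff' subrr enorm_dot dot0l sqrtr0 leNgt invr_gt0.
      by rewrite !mulr_gt0.
    apply/ffunP => i; have := ff (lift ord0 i); rewrite !mxE liftK /=.
    by move/addIr/eqP; rewrite eqr_nat => /eqP/val_inj.
  have -> : ((2 * M).+1 ^ d)%N = size s' by rewrite size_map -cardE card_ffun !card_ord.
  apply: uniq_leq_size => // u /mapP[f _ ->]; rewrite mem_undup.
  by apply/mapP; exists (ord0, true, f); rewrite ?mem_enum.
rewrite card_fseq; apply: leq_trans (size_undup _) _.
by rewrite size_map -cardE !card_prod card_bool card_ffun !card_ord.
Qed.

End sphere_net.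

Lemma sphere_net (R : realType) (d q : nat) : (0 < q)%N ->
  exists U : {fset 'rV[R]_d.+1}, [/\
    forall u, u \in U -> enorm u = 1,
    forall u v, u \in U -> v \in U -> u != v ->
      (16 * d.+1%:R ^+ 2 * q%:R)^-1 <= enorm (u - v),
    forall w, enorm w = 1 -> exists2 u, u \in U & enorm (u - w) <= (4 * q%:R)^-1,
    (q ^ d <= #|` U|)%N &
    (#|` U| <= d.+1 * 2 * (17 * d.+1) ^ d * q ^ d)%N].
Proof.
(* Chosen so that the density [2 * d.+1 / M] becomes [1 / (4 * q)]; also
   [2 * M + 1 <= 17 * d.+1 * q]. *)
move=> q0; pose M := (8 * d.+1 * q)%N.
have M0 : (0 < M)%N by rewrite !muln_gt0.
have expn_mono m n e : (m <= n)%N -> (m ^ e <= n ^ e)%N.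
  by case: e => // e mn; rewrite leq_exp2r.
have [U [UP Ug Ul]] := cube_net R d M0.
have q0' : (q%:R : R) != 0 by rewrite pnatr_eq0 -lt0n.
exists U; split.
- by move=> u /UP[g /(cube_point_neq0 M0)/enorm_normalize + ->].
- move=> u v /UP[g Cg ->] /UP[h Ch ->] uv.
  have gh : g != h by apply: contra_neq uv => ->.
  have := cube_point_sep M0 Cg Ch gh; apply: le_trans.
  by rewrite le_eqVlt; apply/orP; left; rewrite /M !natrM; apply/eqP; congr (_^-1); ring.
- move=> w /(cube_point_dense M0)[g Cg gw]; exists (normalize g).
    by apply/UP; exists g.
  apply: le_trans gw _; rewrite /M !natrM le_eqVlt; apply/orP; left; apply/eqP.
  have : (d.+1%:R : R) != 0 by rewrite pnatr_eq0.
  by move: (d.+1%:R : R) => D D0; field; rewrite q0' D0.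
- apply: leq_trans Ug; apply: expn_mono; rewrite /M; nia.
apply: leq_trans Ul _; rewrite -[leqRHS]mulnA leq_pmul2l ?muln_gt0// -expnMn.
by apply: expn_mono; rewrite /M; nia.
Qed.

(** * Concentric shells: separation, size and layer number *)

Section concentric_shells.
Variables (R : realType) (d N : nat) (i h c : R).
Variables (U : {fset 'rV[R]_d.+1}) (X : {fset 'rV[R]_d}).
Hypotheses (i0 : 0 < i) (h0 : 0 < h) (h1 : h <= 16^-1) (Ni : N%:R * i ^+ 2 <= 1).
Hypothesis U1 : forall u, u \in U -> enorm u = 1.
Hypothesis Usep : forall u v, u \in U -> v \in U -> u != v -> h * i <= enorm (u - v).
Hypothesis Unet : forall w, enorm w = 1 -> exists2 u, u \in U & enorm (u - w) <= i / 4.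
Hypothesis X1 : forall x, x \in X -> enorm x <= 1.
Hypothesis Xsep : forall x y, x \in X -> y \in X -> x != y -> c * i <= edist x y.

(** Here [i] is the mesh of the net and [h * i] its separation. Discs of an eighth of that size
    cannot reach the facets of their neighbours. The radii [r j] increase by [i ^+ 2 / 4] and stay
    between 1/2 and 3/4 for [j <= N]. *)
Let a : R := h * i / 8.
Let r (j : nat) : R := 2^-1 + j%:R * (i ^+ 2 / 4).

Let a0 : 0 < a. Proof. by rewrite /a divr_gt0// mulr_gt0. Qed.

Let a_le : a <= i / 128. Proof.
have : h * i <= 16^-1 * i by rewrite ler_pM2r.
by rewrite /a; lra.
Qed.

Let r_ge j : 2^-1 <= r j.
Proof. by rewrite /r lerDl mulr_ge0// divr_ge0// sqr_ge0. Qed.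

Let r_le j : (j <= N)%N -> r j <= 3 / 4.
Proof.
move=> jN; have : j%:R * i ^+ 2 <= 1.
  by apply: le_trans Ni; rewrite ler_wpM2r ?sqr_ge0// ler_nat.
by rewrite /r; lra.
Qed.

Let rS j : r j.+1 = r j + i ^+ 2 / 4.
Proof. by rewrite /r -natr1; ring. Qed.

(** With [e] the distance of [u] and [v], turning from [v] to [u] costs
    [r j * e ^+ 2 / 2 >= e ^+ 2 / 4] in height, while the disc regains at most
    [a * e <= e ^+ 2 / 8]. *)
Lemma dot_place_neq j u v x : u \in U -> v \in U -> u != v -> x \in X ->
  dot (place (r j) a v x) u <= r j - (h * i) ^+ 2 / 8.
Proof.
move=> uU vU uv xX; have e_ge := Usep uU vU uv; set e := enorm (u - v) in e_ge.
have Tu : dot (tangent v x) u <= e.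
  have := Cauchy_Schwarz (tangent v x) (u - v).
  rewrite dotDr dotNr (dot_tangent_normal x (U1 vU)) subr0 enorm_tangent => /le_trans; apply.
  by rewrite ler_piMl ?enorm_ge0// X1.
rewrite /place dotDl !dotZl (dotC v) (dot_unit (U1 uU) (U1 vU)) -/e.
have : a * dot (tangent v x) u <= a * e by rewrite ler_pM2l.
have hi0 : 0 < h * i by rewrite mulr_gt0.
have := r_ge j; rewrite /a; move: (dot _ _) (r j) => t s s2; nra.
Qed.

Lemma shell_cover j w : (j <= N)%N -> enorm w = 1 ->
  exists2 u, u \in U & forall x, x \in X ->
    r j - 3 / 32 * i ^+ 2 <= dot (place (r j) a u x) w.
Proof.
move=> jN w1; have [u uU uw] := Unet w1; exists u => // x xX.
set e := enorm (u - w) in uw; have e0 : 0 <= e by exact: enorm_ge0.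
have Tw : - e <= dot (tangent u x) w.
  have := Cauchy_Schwarz (tangent u x) (u - w).
  rewrite dotDr dotNr (dot_tangent_normal x (U1 uU)) sub0r enorm_tangent -/e => H.
  rewrite lerNl; apply: le_trans H _.
  by rewrite ler_piMl// X1.
rewrite /place dotDl !dotZl (dot_unit (U1 uU) w1) -/e.
have H : a * - e <= a * dot (tangent u x) w by rewrite ler_pM2l.
have H2 : a * e <= i / 128 * (i / 4) by rewrite ler_pM// ltW.
have H3 : e ^+ 2 <= (i / 4) ^+ 2 by rewrite lerXn2r ?nnegrE// divr_ge0// ltW.
have H4 : r j * (e ^+ 2 / 2) <= 1 * (e ^+ 2 / 2).
  rewrite ler_wpM2r ?divr_ge0 ?sqr_ge0//.
  by apply: le_trans (r_le jN) _; lra.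
by move: (r j) H4 => s H4; nra.
Qed.

(** Shell 0 is the innermost, so the recursion exposes the shell that is peeled first. *)
Fixpoint layered (j : nat) : {fset 'rV[R]_d.+1} :=
  if j is j'.+1 then (shell (r j') a U X `|` layered j')%fset else fset0.

(** A disc sticks out of its sphere by at most [a ^+ 2], which is tiny against the step
    [i ^+ 2 / 4]. That step thus pays for the loss 3/32 of [shell_cover] and for a gap of 1/8. *)
Lemma layered_enorm j p : p \in layered j ->
  enorm p + i ^+ 2 / 8 <= r j - 3 / 32 * i ^+ 2.
Proof.
elim: j => // j IH; rewrite inE => /orP[/shellP[u [x [uU xX ->]]]|/IH]; last first.
  by rewrite rS; have := sqr_ge0 i; lra.
have p_le : enorm (place (r j) a u x) <= r j + a ^+ 2.
  have rj := r_ge j.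
  rewrite -(@ler_pXn2r _ 2%N) ?nnegrE ?enorm_ge0//; last by rewrite addr_ge0 ?sqr_ge0//; lra.
  rewrite (sqr_enorm_place _ _ _ (U1 uU)).
  have : enorm x ^+ 2 <= 1 by rewrite expr_le1 ?X1 ?enorm_ge0.
  by have := sqr_ge0 a; move: (a ^+ 2) (enorm x ^+ 2) => A B; nra.
have : a ^+ 2 <= (i / 128) ^+ 2 by rewrite lerXn2r ?nnegrE ?(ltW a0) ?divr_ge0 ?(ltW i0).
by rewrite rS; move: p_le; have := sqr_ge0 i; lra.
Qed.

Lemma layered_ball p : p \in layered N -> enorm p <= 1.
Proof.
by move=> /layered_enorm; have := r_le (leqnn N); have := sqr_ge0 i; lra.
Qed.

Lemma shell_layered_disjoint j p p' : p \in shell (r j) a U X -> p' \in layered j ->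
  i ^+ 2 / 8 <= edist p p'.
Proof.
move=> /shellP[u [x [uU xX ->]]] /layered_enorm p'_le.
have := Cauchy_Schwarz (place (r j) a u x - p') u.
rewrite dotDl dotNl (dot_place _ _ _ (U1 uU)) (U1 uU) mulr1 -/(edist _ _).
have := Cauchy_Schwarz p' u; rewrite (U1 uU) mulr1.
by have := sqr_ge0 i; lra.
Qed.

(** The three bounds on [b] belong to two points in the same disc, in different discs of one shell,
    and in different shells. *)
Lemma layered_sep b : b <= h * c / 8 -> b <= h ^+ 2 / 8 -> b <= 8^-1 ->
  forall j p p', p \in layered j -> p' \in layered j -> p != p' ->
  b * i ^+ 2 <= edist p p'.
Proof.
move=> b1 b2 b3; have ii : 0 <= i ^+ 2 by exact: sqr_ge0.
have bi : b * i ^+ 2 <= i ^+ 2 / 8 by nra.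
elim=> // j IH p p' /=; rewrite !in_fsetU => /orP[pS|pL] /orP[p'S|p'L] pp'.
- move: pS p'S pp' => /shellP[u [x [uU xX ->]]] /shellP[v [y [vU yX ->]]].
  have [<-|uv] := eqVneq u v => pp'.
    rewrite (edist_place _ _ _ _ (ltW a0)).
    have xy : x != y by apply: contra_neq pp' => ->.
    apply: (@le_trans _ _ (a * (c * i))); first by rewrite /a; nra.
    by rewrite ler_pM2l// Xsep.
  have := dot_place_neq j uU vU uv yX.
  have := Cauchy_Schwarz (place (r j) a u x - place (r j) a v y) u.
  rewrite dotDl dotNl (dot_place _ _ _ (U1 uU)) (U1 uU) mulr1 -/(edist _ _).
  have : b * i ^+ 2 <= (h * i) ^+ 2 / 8 by rewrite exprMn; nra.
  by lra.
- exact: le_trans bi (shell_layered_disjoint pS p'L).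
- by rewrite /edist enormB; exact: le_trans bi (shell_layered_disjoint p'S pL).
- exact: IH.
Qed.

Lemma card_shell j : #|` shell (r j) a U X| = (#|` U| * #|` X|)%N.
Proof.
rewrite card_fseq undup_id ?size_allpairs// allpairs_uniq ?fset_uniq//.
move=> _ _ /allpairsP[[u x] /= [uU xX ->]] /allpairsP[[v y] /= [vU yX ->]] /= pE.
have uv : u = v.
  apply/eqP/negPn/negP => uv; have := dot_place_neq j uU vU uv yX.
  by rewrite -pE (dot_place _ _ _ (U1 uU)) lerBrDl gerDr leNgt divr_gt0// exprn_gt0// mulr_gt0.
by move: pE; rewrite uv => /(place_inj a0) ->.
Qed.

Lemma card_layered j : #|` layered j| = (j * (#|` U| * #|` X|))%N.
Proof.
elim: j => [|j IH]; first by rewrite cardfs0.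
rewrite cardfsU (_ : (_ `&` _)%fset = fset0) ?cardfs0 ?subn0 ?card_shell ?IH ?mulSn//.
apply/fsetP => p; rewrite in_fsetI in_fset0; apply/negP => /andP[pS pL].
have := shell_layered_disjoint pS pL.
by rewrite /edist subrr enorm_dot dot0l sqrtr0 leNgt divr_gt0// exprn_gt0.
Qed.

Lemma layer_number_layered j : (j <= N)%N ->
  layer_number (layered j) = (j * layer_number X)%N.
Proof.
elim: j => [|j IH] jN; first by rewrite layer_number0.
rewrite /= (@layer_number_shell _ _ _ _ (r j - 3 / 32 * i ^+ 2)) ?IH ?(ltnW jN) ?mulSn//.
- by have := sqr_ge0 i; lra.
- move=> u v x uU vU uv xX; apply: le_lt_trans (dot_place_neq j uU vU uv xX) _.
  by rewrite gtrBl divr_gt0// exprn_gt0// mulr_gt0.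
- by move=> p /layered_enorm; have := exprn_gt0 2 i0; lra.
- by move=> w; apply: shell_cover; exact: ltnW.
Qed.

(** Supplies the upper bound on the minimum distance: the same [u] and [x] on two consecutive shells
    differ by [(i ^+ 2 / 4) *: u]. *)
Lemma layered_close : X != fset0 -> (1 < N)%N ->
  exists p p', [/\ p \in layered N, p' \in layered N, p != p' & edist p p' <= i ^+ 2].
Proof.
move=> /fset0Pn[x xX]; case: N => [|[|n]]// _.
have [|u uU _] := Unet (w := delta_mx 0 0).
  rewrite /enorm big_ord_recl mxE !eqxx expr1n big1 ?addr0 ?sqrtr1// => k _.
  by rewrite mxE /= expr0n.
have pd : place (r n.+1) a u x - place (r n) a u x = (i ^+ 2 / 4) *: u.
  by rewrite /place rS; apply/rowP => k; rewrite !mxE; ring.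
have i2 : 0 < i ^+ 2 by rewrite exprn_gt0.
have dE : edist (place (r n.+1) a u x) (place (r n) a u x) = i ^+ 2 / 4.
  by rewrite /edist pd enormZ (U1 uU) mulr1 gtr0_norm// divr_gt0.
exists (place (r n.+1) a u x), (place (r n) a u x); split.
- by rewrite inE; apply/orP; left; apply/shellP; exists u, x.
- by rewrite inE; apply/orP; right; rewrite inE; apply/orP; left; apply/shellP; exists u, x.
- apply: contraTneq i2 => pE; move: dE; rewrite pE /edist subrr enorm_dot dot0l sqrtr0.
  by lra.
- by rewrite dE; lra.
Qed.

End concentric_shells.

(** The shells are taken with mesh [i = 1 / q] and [N = q ^ 2], so that [N * i ^+ 2 = 1]. *)
Lemma concentric_step (R : realType) (d q : nat) (c : R) (X : {fset 'rV[R]_d}) :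
  0 < c -> c <= 1 -> (0 < q)%N -> X != fset0 ->
  (forall x, x \in X -> enorm x <= 1) ->
  (forall x y, x \in X -> y \in X -> x != y -> c / q%:R <= edist x y) ->
  exists Y : {fset 'rV[R]_d.+1},
    [/\ forall p, p \in Y -> enorm p <= 1,
        forall p p', p \in Y -> p' \in Y -> p != p' ->
          c * (16 * d.+1%:R ^+ 2)^-1 ^+ 2 / 8 / (q ^ 2)%:R <= edist p p',
        (q ^ d.+2 * #|` X| <= #|` Y| <=
          d.+1 * 2 * (17 * d.+1) ^ d * (q ^ d.+2 * #|` X|))%N,
        layer_number Y = (q ^ 2 * layer_number X)%N &
        (1 < q)%N -> exists p p', [/\ p \in Y, p' \in Y, p != p' &
          edist p p' <= (q ^ 2)%:R^-1]].
Proof.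
move=> c0 c1 q0 Xn0 X1 Xsep; have [U [U1 Usep Unet Ug Ul]] := sphere_net R d q0.
set h : R := (16 * d.+1%:R ^+ 2)^-1.
have q0' : 0 < q%:R :> R by rewrite ltr0n.
pose i : R := q%:R^-1; have i0 : 0 < i by rewrite invr_gt0.
have D1 : 1 <= d.+1%:R ^+ 2 :> R by rewrite -natrX ler1n expn_gt0.
have h0 : 0 < h by rewrite invr_gt0 mulr_gt0// (lt_le_trans _ D1).
have h1 : h <= 16^-1.
  by rewrite lef_pV2 ?posrE ?ler_peMr// -invr_gt0.
have i2 : i ^+ 2 = (q ^ 2)%:R^-1 by rewrite /i natrX exprVn.
have Ni : (q ^ 2)%:R * i ^+ 2 <= 1 by rewrite i2 mulfV// pnatr_eq0 -lt0n expn_gt0 q0.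
have Usep' u v : u \in U -> v \in U -> u != v -> h * i <= enorm (u - v).
  by move=> uU vU uv; have := Usep u v uU vU uv; rewrite -invfM.
have Unet' w : enorm w = 1 -> exists2 u, u \in U & enorm (u - w) <= i / 4.
  by move=> /Unet[u uU uw]; exists u => //; rewrite mulrC -invfM.
exists (layered i h U X (q ^ 2)); split.
- exact: (layered_ball i0 h0 h1 Ni U1 X1).
(* As [c] and [h] are at most 1, [c * h ^+ 2 / 8] meets all three bounds of [layered_sep]. *)
- have hh : h ^+ 2 <= h by nra.
  have hh0 : 0 < h ^+ 2 by rewrite exprn_gt0.
  by rewrite -i2 => p p'; apply: (layered_sep i0 h0 h1 U1 Usep' X1 Xsep); nra.
- rewrite (card_layered i0 h0 h1 U1 Usep' X1).
  have -> : (q ^ d.+2 = q ^ 2 * q ^ d)%N by rewrite -expnD.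
  apply/andP; split; first by rewrite -[leqLHS]mulnA leq_mul2l leq_mul2r Ug !orbT.
  apply: leq_trans (leq_mul (leqnn _) (leq_mul Ul (leqnn _))) _.
  move: (d.+1 * 2 * _)%N (q ^ 2)%N (q ^ d)%N #|` X|%fset => C P Q B.
  by rewrite -!mulnA mulnCA.
- exact: (layer_number_layered i0 h0 h1 Ni U1 Usep' Unet' X1).
- move=> q1; rewrite -i2; apply: layered_close => //.
  by rewrite (ltn_exp2l 0).
Qed.

(** * Induction on the dimension *)

Lemma layer_number_fset1 (R : realType) (d : nat) (x : 'rV[R]_d) :
  layer_number [fset x]%fset = 1%N.
Proof.
have x0 : [fset x]%fset != fset0 by apply/fset0Pn; exists x; rewrite inE.
have := peel_lt x0; rewrite cardfs1 ltnS leqn0 cardfs_eq0 => /eqP px.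
rewrite (@layer_number_iter _ _ 1) /= ?px ?layer_number0//.
by case.
Qed.

(** The scale [q = n ^ 2 ^ d] of dimension [d] becomes [q ^ 2], and the layer number gains the
    factor [q ^ 2], so its exponent grows to [2 ^ d.+1 + (2 ^ d.+1 - 2)]. A close pair needs two
    shells, hence [0 < d] and [1 < n]. *)
Lemma layered_family (R : realType) (d : nat) : exists (c : R) (K : nat), [/\ 0 < c, c <= 1 &
  forall n, (0 < n)%N -> exists X : {fset 'rV[R]_d}, let m := (n ^ 2 ^ d)%N in
    [/\ forall p, p \in X -> enorm p <= 1,
        forall p p', p \in X -> p' \in X -> p != p' -> c / m%:R <= edist p p',
        (m ^ d <= #|` X| <= K * m ^ d)%N,
        layer_number X = (n ^ (2 ^ d.+1 - 2))%N &
        (0 < d)%N -> (1 < n)%N -> exists p p', [/\ p \in X, p' \in X, p != p' &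
          edist p p' <= m%:R^-1]]].
Proof.
elim: d => [|d [c [K [c0 c1 H]]]].
  (* The single point of R^0 has layer number [1 = n ^ 0]. *)
  exists 1, 1%N; split=> // n n0; exists [fset 0]%fset; split=> //.
  - by move=> p; rewrite inE => /eqP ->; rewrite enorm_dot dot0l sqrtr0.
  - by move=> p p'; rewrite !inE => /eqP -> /eqP ->; rewrite eqxx.
  - by rewrite cardfs1.
  - by rewrite layer_number_fset1.
have D1 : 1 <= d.+1%:R ^+ 2 :> R by rewrite -natrX ler1n expn_gt0.
have hpos : 0 < (16 * d.+1%:R ^+ 2)^-1 :> R by rewrite invr_gt0 mulr_gt0// (lt_le_trans _ D1).
exists (c * (16 * d.+1%:R ^+ 2)^-1 ^+ 2 / 8), (d.+1 * 2 * (17 * d.+1) ^ d * K)%N; split.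
- by rewrite divr_gt0// mulr_gt0// exprn_gt0.
- have h1 : (16 * d.+1%:R ^+ 2)^-1 <= 1 :> R.
    by rewrite invf_le1; [lra|rewrite -invr_gt0].
  have h2 : (16 * d.+1%:R ^+ 2)^-1 ^+ 2 <= 1 :> R by rewrite expr_le1 ?(ltW hpos).
  have := ler_pM (ltW c0) (sqr_ge0 _) c1 h2; rewrite mulr1 => ch.
  rewrite ler_pdivrMr// mul1r; apply: le_trans ch _; lra.
move=> n n0; have [X [X1 Xsep /andP[Xge Xle] XL _]] := H n n0.
set q := (n ^ 2 ^ d)%N in X1 Xsep Xge Xle XL *.
have q0 : (0 < q)%N by rewrite expn_gt0 n0.
have Xn0 : X != fset0.
  by rewrite -cardfs_eq0 -lt0n; apply: leq_trans Xge; rewrite expn_gt0 q0.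
have [Y [Y1 Ysep /andP[Yge Yle] YL Yclose]] := concentric_step c0 c1 q0 Xn0 X1 Xsep.
have mq : (n ^ 2 ^ d.+1 = q ^ 2)%N by rewrite /q -expnM expnSr.
have qd : ((q ^ 2) ^ d.+1 = q ^ d.+2 * q ^ d)%N.
  by rewrite -expnM -expnD; congr (_ ^ _)%N; lia.
exists Y; rewrite /= mq qd; split=> //.
- apply/andP; split; first by apply: leq_trans _ Yge; rewrite leq_mul2l Xge orbT.
  apply: leq_trans Yle _; rewrite -[leqRHS]mulnA leq_mul2l; apply/orP; right.
  by rewrite mulnCA leq_mul2l Xle orbT.
- rewrite YL XL -mq -expnD; congr (_ ^ _)%N.
  by have := expn_gt0 2 d; rewrite !expnS; lia.
move=> _ n1; apply: Yclose.
by rewrite /q -[ltnLHS](exp1n (2 ^ d)%N) ltn_exp2r ?expn_gt0.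
Qed.

(** * Asymptotics in terms of the cardinality *)

Lemma eq_Theta_bounds (R : realType) (f g : nat -> R) (k1 k2 : R) :
  0 < k1 -> 0 < k2 -> (forall i, 0 <= g i) ->
  (forall i, k1 * g i <= f i <= k2 * g i) -> f =Theta_\oo g.
Proof.
move=> k10 k20 g0 fg; rewrite eqThetaE qualifE; apply/asboolP.
exists (k1, k2); first by rewrite /= k10.
near=> i; have /andP[fg1 fg2] := fg i.
have f0 : 0 <= f i by apply: le_trans fg1; rewrite mulr_ge0// ltW.
by rewrite !ger0_norm.
Unshelve. all: by end_near. Qed.

(** The absolute value lets one constant serve both signs of [b]. *)
Lemma powR_bounds (R : realType) (t k b : R) : 1 <= t -> t <= k ->
  (k `^ `|b|)^-1 <= t `^ b <= k `^ `|b|.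
Proof.
move=> t1 tk; have t0 : 0 < t by exact: lt_le_trans t1.
have k0 : 0 < k by exact: lt_le_trans tk.
have tkb : t `^ `|b| <= k `^ `|b| by rewrite ge0_ler_powR ?nnegrE ?(ltW t0) ?(ltW k0).
apply/andP; split; last by apply: le_trans tkb; rewrite ler_powR// ler_norm.
apply: (@le_trans _ _ (t `^ (- `|b|))); last by rewrite ler_powR// lerNl -normrN ler_norm.
by rewrite powRN lef_pV2 ?posrE ?powR_gt0.
Qed.

(** Matches the exponent of [n] in the layer number with that of [m ^ d], where [m = n ^ 2 ^ d]. *)
Lemma exponentE (R : realType) (d : nat) : (0 < d)%N ->
  (2 ^ d.+1)%:R - 2%:R =
    (2 ^ d)%:R * (d%:R * (2 / d%:R - 1 / (d%:R * 2 ^+ (d - 1)))) :> R.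
Proof.
case: d => // d _; rewrite subSS subn0 !natrX !exprS.
have : d.+1%:R != 0 :> R by rewrite pnatr_eq0.
have : 2 ^+ d != 0 :> R by rewrite expf_neq0.
by move: (2 ^+ d) (d.+1%:R) => x y x0 y0; field; rewrite x0 y0.
Qed.

Theorem theorem1p7 (R : realType) (d : nat) (hd : (1 <= d)%N) :
  exists X : nat -> {fset 'rV[R]_d},
    evenly_distributed X /\
    (fun i => (layer_number (X i))%:R : R) =Theta_\oo
      (fun i => #|` X i|%:R `^ (2 / d%:R - 1 / (d%:R * 2 ^+ (d - 1)))).
Proof.
have [c [K [c0 c1 H]]] := layered_family R d.
(* Starting at [n = 2] guarantees the close pair at every index. *)
have [X XP] := choice (fun i : nat => H i.+2 isT).
pose m (i : nat) := (i.+2 ^ 2 ^ d)%N.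
have m0 i : (0 < m i)%N by rewrite expn_gt0.
have mR0 i : 0 < (m i)%:R :> R by rewrite ltr0n.
have mi i : (i <= m i)%N.
  apply: leq_trans (leqnSn _) _; apply: leq_trans (leqnSn _) _.
  by rewrite /m -[leqLHS]expn1 leq_exp2l// expn_gt0.
have Xge i : ((m i) ^ d <= #|` X i|)%N by case: (XP i) => _ _ /andP[].
have Xi i : (i <= #|` X i|)%N.
  apply: leq_trans (Xge i); apply: leq_trans (mi i) _.
  by rewrite -[leqLHS]expn1 leq_pexp2l.
have K0 : (0 < K%:R :> R).
  have [_ _ /andP[_ KX] _ _] := XP 0%N; have := leq_trans (Xge 0%N) KX.
  by rewrite ltr0n; case: K {H XP KX} => //; rewrite mul0n leqn0 expn_eq0 gtn_eqF ?m0.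
(* The cardinality is [m i ^ d] times a ratio in [[1, K]], so a power [b] of it is known up to the
   factor [K] to the power [|b|]. *)
have Xpow b i : 
    (K%:R `^ `|b|)^-1 * (m i)%:R `^ (d%:R * b) <= #|` X i|%:R `^ b :> R
    /\ #|` X i|%:R `^ b <= K%:R `^ `|b| * (m i)%:R `^ (d%:R * b) :> R.
  have md0 : 0 < ((m i) ^ d)%:R :> R by rewrite ltr0n expn_gt0 m0.
  pose t : R := #|` X i|%:R / ((m i) ^ d)%:R.
  have t1 : 1 <= t by rewrite /t ler_pdivlMr// mul1r ler_nat.
  have tK : t <= K%:R.
    by rewrite /t ler_pdivrMr// -natrM ler_nat; case: (XP i) => _ _ /andP[].
  have -> : #|` X i|%:R `^ b = t `^ b * (m i)%:R `^ (d%:R * b).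
    rewrite powRrM powR_mulrn ?ler0n// -natrX -powRM ?ler0n//; last by rewrite divr_ge0 ?ler0n.
    by rewrite /t divfK// gt_eqF.
  have /andP[tb1 tb2] := powR_bounds b t1 tK.
  by split; rewrite ler_wpM2r// powR_ge0.
exists X; split; first split.
- by move=> i p; have [+ _ _ _ _] := XP i; exact.
- apply/cvgnyPge => A; near=> i; apply: leq_trans (Xi i).
  by near: i; exact: nbhs_infty_ge.
- set b : R := - _; set k := K%:R `^ `|b|.
  have k0 : 0 < k by rewrite powR_gt0.
  have mE i : (m i)%:R `^ (d%:R * b) = (m i)%:R^-1 :> R.
    by rewrite /b mulrN mulfV ?powR_inv1 ?pnatr_eq0 -?lt0n ?ltW.
  apply: (@eq_Theta_bounds _ _ _ (c / k) k) => //.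
  + by rewrite divr_gt0.
  move=> i; have := Xpow b i; rewrite -/k mE => -[Xb1 Xb2].
  have [_ sep _ _ /(_ hd isT)[p [p' [pX p'X pp' close]]]] := XP i.
  have X1 : (1 < #|` X i|)%N.
    apply: leq_trans (Xge i).
    by rewrite -[ltnLHS](exp1n d) ltn_exp2r// -[ltnLHS](exp1n (2 ^ d)%N) ltn_exp2r//
      expn_gt0.
  have [[x [y [xX yX xy minE]]] minle] := min_distP X1.
  (* The lower bound uses the separation of all pairs, the upper bound the one close pair. *)
  apply/andP; split.
    rewrite minE; apply: le_trans (sep _ _ xX yX xy).
    by rewrite -mulrA ler_pM2l// ler_pdivrMl.
  apply: le_trans (minle _ _ pX p'X pp') _; apply: le_trans close _.
  by rewrite -ler_pdivrMl.
set b : R := _ - _; set k := K%:R `^ `|b|.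
have k0 : 0 < k by rewrite powR_gt0.
have LE i : (layer_number (X i))%:R = (m i)%:R `^ (d%:R * b) :> R.
  have [_ _ _ -> _] := XP i; rewrite /m !natrX -!powR_mulrn ?ler0n// -powRrM.
  congr (_ `^ _); rewrite natrB; last by rewrite -[leqLHS]expn1 leq_exp2l.
  by rewrite /b -exponentE.
apply: (@eq_Theta_bounds _ _ _ k^-1 k) => //.
- by rewrite invr_gt0.
move=> i; rewrite LE; have := Xpow b i; rewrite -/k => -[Xb1 Xb2].
by apply/andP; split; [rewrite ler_pdivrMl|rewrite -ler_pdivrMl].
Unshelve. all: by end_near. Qed.
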